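(* Let $k>1$. Any algorithm that solves the black hole search problem in dynamic cactus graphs $\mathcal{G}$ with at most $k$ dynamic edges at any round requires at least $k+2$ agents.
   Context: Cactus graph: a connected undirected graph in which any two distinct simple cycles share at most one vertex (equivalently, every edge lies on at most one simple cycle). Dynamic cactus graph with at most $k$ dynamic edges at any round: a fixed cactus (the footprint, $G_0$) on a static vertex set $V$ with $|V|=n$, together with a sequence of graphs $G_0,G_1,G_2,\dots$, $G_r=(V,E_r)$, where $G_r$ is the footprint with at most $k$ edges missing, and each $G_r$ is connected ($1$-interval connectivity). At each round an adversary chooses which edges are missing; missing edges may reappear later. The degree $\deg(v)$ is the degree in $G_0$; $\Delta$ is the maximum degree. Nodes are anonymous. At each node $v$ the incident edges carry distinct port numbers $0,\dots,\deg(v)-1$ (in counter-clockwise order); the two port numbers of an edge are unrelated. Each node $v$ has a whiteboard of $O(\deg(v)(\log\deg(v)+k\log k))$ bits, readable and writable by visiting agents under fair mutual exclusion. Black hole: one node of the graph is a black hole; every agent entering it is destroyed without a trace. Agents: a set of $m\le n$ agents with distinct Ids in $[1,m]$, initially co-located at a node called home that is known not to be the black hole. All agents execute the same deterministic algorithm; each has $O(n\log\Delta)$ bits of memory. An agent at a node sees the degree, which incident edges are currently missing, the whiteboard, and the Ids of the other agents there, and can communicate with these agents. When moving along an edge it knows the port by which it leaves and the port by which it arrives. Any number of agents may use an edge simultaneously. Rounds: in every synchronous round each agent communicates (with co-located agents and via the whiteboard), computes a decision to stay or to leave through a port, and then moves (traversing a present edge takes one round). Black hole search problem (BHS): within finitely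 many rounds, at least one agent must survive, know the location of the black hole, and terminate, whatever the footprint, its port numbering, the location of the black hole, and the adversary's choice of missing edges. An algorithm solves BHS in this class if it does so on every dynamic cactus graph with at most $k$ dynamic edges at any round. *)

(* Defs.v *)
From mathcomp Require Import all_boot.

Set Implicit Arguments.
Unset Strict Implicit.
Unset Printing Implicit Defensive.

(* The neighbours of v are listed in port order: port p of v leads to the p-th
   item of links v. *)
Record network := Network {
  node : finType;
  links : node -> seq node
}.
Arguments links {n} v.

Section Graphs.
Variable G : network.
Implicit Types (x y v : node G) (c : seq (node G)) (M : {set {set node G}}).

Definition deg v := size (links v).
Definition max_deg := \max_(v : node G) deg v.
Definition adj : rel (node G) := fun x y => y \in links x.
Definition port v x := index x (links v).

Definition simple_graph :=
  [/\ forall v, uniq (links v), symmetric adj & irreflexive adj].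

Definition edges : {set {set node G}} :=
  [set [set x; y] | x in [set: node G], y in links x].

(* The footprint deprived of the edges of M. *)
Definition present M : rel (node G) :=
  fun x y => adj x y && ([set x; y] \notin M).

Definition connected_without M := forall x y, connect (present M) x y.

Definition simple_cycle c := 2 < size c /\ ucycle adj c.

(* A cyclic sequence, its rotations and its reversal are the same cycle of the
   graph, hence cycles are compared through their edge sets. *)
Definition cycle_edges c : {set {set node G}} :=
  [set [set x; next c x] | x in c].

Definition cactus :=
  [/\ simple_graph, connected_without set0 &
      forall c1 c2, simple_cycle c1 -> simple_cycle c2 ->
        cycle_edges c1 = cycle_edges c2 \/ #|[predI c1 & c2]| <= 1].

(* The port numbers are a counter-clockwise order around every node of some
   plane drawing: as two cycles of a cactus meet in at most one node, they do
   not cross there, that is, their ports at that node do not alternate. For a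
   cactus this is also sufficient for such a drawing to exist, bridges and
   cycles being free to be drawn on either side of one another. *)
Definition ccw_ports :=
  forall c1 c2 v, simple_cycle c1 -> simple_cycle c2 -> v \in c1 -> v \in c2 ->
    ~ [/\ port v (next c1 v) < port v (next c2 v),
          port v (next c2 v) < port v (prev c1 v) &
          port v (prev c1 v) < port v (prev c2 v)].

(* The port numbers s, followed from x in the footprint, lead to y. *)
Fixpoint leads (s : seq nat) x y : bool :=
  if s is p :: s' then (p < deg x) && leads s' (nth x (links x) p) y
  else x == y.

End Graphs.

Record scenario := Scenario {
  footprint : network;
  missing : nat -> {set {set node footprint}};
  home : node footprint;
  black_hole : node footprint
}.

(* Dynamic cactus with at most k missing edges at any round, with m agents. *)
Record admissible (k m : nat) (S : scenario) : Prop := Admissible {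
  adm_cactus : cactus (footprint S);
  adm_ports : ccw_ports (footprint S);
  adm_round0 : missing S 0 = set0;
  adm_missing : forall r, missing S r \subset edges (footprint S);
  adm_bound : forall r, #|missing S r| <= k;
  adm_connected : forall r, connected_without (missing S r);
  adm_agents : m <= #|node (footprint S)|;
  adm_home : home S != black_hole S
}.

(* What is perceived at a node by the agents there. Communication between
   co-located agents is unrestricted, so they share their whole memories:
   view_agents lists, by increasing Id, the Id, the memory and (if the agent
   moved in the previous round) the port of arrival of every agent there. *)
Record view := View {
  view_deg : nat;
  view_missing : seq nat;
  view_board : seq bool;
  view_agents : seq (nat * seq bool * option nat)
}.

Inductive action := Stay | Leave of nat | Terminate.

(* The first argument of init, decide and update is the Id of the agent
   executing the algorithm. As co-located agents share the same view, the
   content of the whiteboard after all of them have accessed it in turn is a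
   function of that view alone. *)
Record algorithm := Algorithm {
  init : nat -> seq bool;
  decide : nat -> view -> action;
  update : nat -> view -> seq bool;
  write : view -> seq bool
}.

Record agent (T : Type) := Agent {
  pos : T;
  memory : seq bool;
  entry : option nat;
  halted : bool
}.

Section Execution.
Variables (m : nat) (A : algorithm) (S : scenario).
Local Notation V := (node (footprint S)).

(* A destroyed agent is None. *)
Record config := Config {
  agents : 'I_m -> option (agent V);
  board : V -> seq bool
}.

Definition ident (i : 'I_m) : nat := i.+1.

Definition agent_at (c : config) (v : V) (i : 'I_m) :
    option (nat * seq bool * option nat) :=
  if agents c i is Some a then
    if pos a == v then Some (ident i, memory a, entry a) else None
  else None.

Definition active_at (c : config) (v : V) (i : 'I_m) : bool :=
  if agents c i is Some a then (pos a == v) && ~~ halted a else false.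

Definition missing_ports (r : nat) (v : V) : seq nat :=
  [seq p <- iota 0 (deg v) | [set v; nth v (links v) p] \in missing S r].

Definition view_at (r : nat) (c : config) (v : V) : view :=
  View (deg v) (missing_ports r v) (board c v)
       (pmap (agent_at c v) (enum 'I_m)).

(* Leaving through a missing edge or a nonexistent port amounts to staying. A
   terminated agent remains where it is, and its last memory stays readable. *)
Definition step_agent (r : nat) (c : config) (i : 'I_m) : option (agent V) :=
  if agents c i is Some a then
    if halted a then Some a else
    let x := pos a in
    let w := view_at r c x in
    let mu := update A (ident i) w in
    match decide A (ident i) w with
    | Stay => Some (Agent x mu None false)
    | Terminate => Some (Agent x mu None true)
    | Leave p =>
        let y := nth x (links x) p in
        if (p < deg x) && present (missing S r) x y then
          if y == black_hole S then None
          else Some (Agent y mu (Some (port y x)) false)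
        else Some (Agent x mu None false)
    end
  else None.

Definition step (r : nat) (c : config) : config :=
  Config (step_agent r c)
    (fun v => if [exists i, active_at c v i] then write A (view_at r c v)
              else board c v).

Definition start : config :=
  Config (fun i => Some (Agent (home S) (init A (ident i)) None false))
         (fun _ => [::]).

(* The configuration at the beginning of round r. *)
Fixpoint run (r : nat) : config :=
  if r is r'.+1 then step r' (run r') else start.

End Execution.

(* O(n log Delta) bits per agent and O(deg(v)(log deg(v) + k log k)) bits per
   whiteboard. The .+1 only matters for Delta <= 1, where the logarithm
   vanishes. *)
Definition within_space (k m : nat) (A : algorithm) : Prop :=
  exists C : nat, forall S, admissible k m S -> forall r,
    (forall i a, agents (run m A S r) i = Some a ->
       size (memory a) <=
         C * (#|node (footprint S)| * up_log 2 (max_deg (footprint S))).+1) /\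
    (forall v, size (board (run m A S r) v) <=
         C * (deg v * (up_log 2 (deg v) + k * up_log 2 k))).

(* Agent i, having view w, knows where the black hole is: nodes being
   anonymous, a location is a sequence of ports from the node of the agent; it
   is known if it is correct in all the situations that agent i, having view w,
   cannot distinguish. *)
Definition knows_black_hole (k m : nat) (A : algorithm) (i : 'I_m) (w : view) :
    Prop :=
  exists s : seq nat, forall S, admissible k m S -> forall r a,
    agents (run m A S r) i = Some a -> ~~ halted a ->
    view_at r (run m A S r) (pos a) = w ->
    leads s (pos a) (black_hole S).

(* A terminating agent does not move any more, hence survives. *)
Definition solves_BHS (k m : nat) (A : algorithm) : Prop :=
  forall S, admissible k m S -> exists r i a,
    let w := view_at r (run m A S r) (pos a) in
    [/\ agents (run m A S r) i = Some a, ~~ halted a,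
        decide A (ident i) w = Terminate & knows_black_hole k A i w].

(* Main.v *)
(* Let k = K + 1, and suppose that at most K + 2 agents take part. The footprint
   is a chain of K triangles that starts next to home and ends with a
   quadrilateral w x y z, attached at w. In every triangle the adversary removes
   one of the two edges leading on: the one that starts from the entrance of the
   triangle if someone is there, the other one otherwise. By induction along the
   chain, each triangle retains one more agent, so that at any time at most two
   agents are dead or in the quadrilateral.

   In the quadrilateral w z is missing until somebody enters x; from then on w x
   is missing. If x is the black hole, it has killed the first agent, and a
   second one that comes to y through z is cut off from z. If y is the black
   hole, it kills the second agent, and the first one, if alive, is cut off at x.
   Everywhere else these two runs look the same, so the agent that terminates is
   at y in the former and at x in the latter; the former shows that a single
   agent has entered x, hence the agent that terminates in the latter is alone at
   x. It would see the same if z were the black hole: nobody could reach it. *)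

Require Import Defs.
From mathcomp Require Import all_boot.
From mathcomp Require Import zify.

Set Implicit Arguments.
Unset Strict Implicit.
Unset Printing Implicit Defensive.

(** The iterates of [next c] from [v] run through all of [c]. *)
Lemma next_closed (T : finType) (c : seq T) v (P : pred T) :
    uniq c -> v \in c -> P v -> {in c, forall u, P u -> P (next c u)} ->
  {in c, forall u, P u}.
Proof.
move=> Uc vc Pv PS u.
rewrite -(fconnect_cycle (cycle_next Uc) vc) => /iter_findex <-.
suff: forall n, (iter n (next c) v \in c) && P (iter n (next c) v).
  by move=> /(_ (findex (next c) v u)) /andP[].
by elim=> [|n /andP[nc Pn]] /=; rewrite ?vc // mem_next nc PS.
Qed.

(** Otherwise [v] and [next c v] would be closed under [next c], and [c] would have at most two
    nodes. *)
Lemma next_neq_prev (T : finType) (c : seq T) v :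
  uniq c -> 2 < size c -> v \in c -> next c v != prev c v.
Proof.
move=> Uc c_gt2 vc; apply/eqP => nv.
have cl : {in c, forall u, u \in [:: v; next c v]}.
  apply: (next_closed Uc vc); first by rewrite inE eqxx.
  move=> u _; rewrite !inE => /orP[]/eqP->; first by rewrite eqxx orbT.
  by rewrite {1}nv next_prev // eqxx.
by have := uniq_leq_size Uc cl; rewrite leqNgt c_gt2.
Qed.

(** * The footprint *)

Section Footprint.
Variable K : nat.
Local Notation V := 'I_(K.*2 + 4).+1.

(* Node 0 is home; 2i+1, 2i+2, 2i+3 form a triangle for every i < K, and
   w = 2K+1, x = 2K+2, y = 2K+3, z = 2K+4 form the last cycle. The relation [up]
   lists every edge from its smaller end. *)
Definition up (a b : nat) :=
  [|| b == a.+1, [&& odd a, b == a.+2 & b <= K.*2.+1]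
    | (a == K.*2.+1) && (b == K.*2.+4)].
Definition nbr a b := up a b || up b a.

Definition chain : network :=
  @Network V (fun v => [seq u : V <- enum V | nbr v u]).

Lemma adjE (u v : node chain) : adj u v = nbr u v.
Proof. by rewrite /adj mem_filter mem_enum andbT. Qed.

Lemma chain_simple : simple_graph chain.
Proof.
split=> [v|u v|v]; first by rewrite filter_uniq ?enum_uniq.
  by rewrite !adjE /nbr orbC.
by rewrite adjE /nbr /up; lia.
Qed.

(** [links] is sorted by node number, so conditions on ports become inequalities between nodes. *)
Lemma port_lt (v a b : node chain) : adj v a -> adj v b ->
  port v a < port v b -> a < b.
Proof.
move=> va vb.
have S : sorted (relpre val ltn) (links v).
  apply: sorted_filter; first by move=> ? ? ? /=; lia.
  by rewrite -sorted_map val_enum_ord iota_ltn_sorted.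
apply: (@sorted_ltn_index _ (relpre val ltn) _ _ S a b va vb).
by move=> ? ? ? /=; lia.
Qed.

(** A block is one of the cycles, named by its least node [j]; the quadrilateral, which starts at w,
    has one node more than the triangles. *)
Definition top (j : nat) := if j == K.*2.+1 then j + 3 else j + 2.

Definition in_block j (v : V) := j <= v <= top j.

Definition block_edges j : {set {set V}} :=
  [set E | [exists u, exists v,
    [&& E == [set u; v], in_block j u, in_block j v & nbr u v]]].

(** * Cycles of the chain *)

Lemma chain_next (c : seq (node chain)) (v : node chain) :
  simple_cycle c -> v \in c -> nbr v (next c v).
Proof. by case=> _ /andP[cyc _] vc; rewrite -adjE; apply: next_cycle. Qed.

Lemma chain_prev (c : seq (node chain)) (v : node chain) :
  simple_cycle c -> v \in c -> nbr v (prev c v).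
Proof.
case=> _ /andP[cyc _] vc; rewrite /nbr orbC -/(nbr _ _) -adjE.
exact: prev_cycle.
Qed.

(** A cycle that comes to a node below [top j] from its predecessor can only go on to its successor,
    the sole other neighbour not below [j]. *)
Lemma ascending_cycle (c : seq (node chain)) (j : V) :
    simple_cycle c -> j \in c -> {in c, forall v : V, j <= v} ->
    next c j = j.+1 :> nat -> prev c j = top j :> nat ->
    odd j -> j <= K.*2.+1 ->
  (forall v, (v \in c) = in_block j v) /\
  (forall u v : V, in_block j u -> in_block j v -> nbr u v ->
     next c u = v \/ next c v = u).
Proof.
move=> C jc jmin fj gj j_odd jK; have [c_gt2 /andP[cyc Uc]] := C.
have W : forall n, forall v : V, v = n + j :> nat -> v < top j ->
    v \in c /\ next c v = v.+1 :> nat.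
  elim=> [|n IHn] v vE vt; first by have -> : v = j by apply: val_inj.
  have u_ok : n + j < (K.*2 + 4).+1 by have := ltn_ord v; lia.
  have [||uc fu] := IHn (Ordinal u_ok); rewrite //=; first by lia.
  have {}fu : next c (Ordinal u_ok) = v.
    by apply: val_inj; rewrite [LHS]fu [RHS]vE.
  have vc : v \in c by rewrite -fu mem_next.
  have := chain_next C vc; have := next_neq_prev Uc c_gt2 vc.
  have -> : prev c v = Ordinal u_ok by rewrite -fu prev_next.
  have : next c v \in c by rewrite mem_next.
  move/jmin; rewrite -val_eqE /=.
  move: vt vE; rewrite /nbr /up /top => vt vE ? ? ?; split=> //.
  by move: vt; case: (nat_of_ord j =P K.*2.+1) => ?; lia.
have topV : top j < (K.*2 + 4).+1 by rewrite /top; case: eqP; lia.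
pose t : V := Ordinal topV.
have jt : j < top j by rewrite /top; case: eqP; lia.
have tP (v : V) : v = top j :> nat -> v = t by move=> vt; apply: val_inj.
have tc : t \in c by rewrite -(tP _ gj) mem_prev.
have nt : next c t = j by rewrite -(tP _ gj) next_prev.
have {}W (v : V) : j <= v < top j -> v \in c /\ next c v = v.+1 :> nat.
  by case/andP=> jv; apply: (W (v - j)); lia.
have IB v : (v \in c) = in_block j v.
  apply/idP/idP => [|/andP[jv]]; last first.
    rewrite leq_eqVlt => /orP[/eqP/tP->//|vt].
    by case: (W v); rewrite // jv.
  move: v; apply: (next_closed Uc jc); first by rewrite /in_block leqnn ltnW.
  move=> u uc /andP[ju]; rewrite leq_eqVlt => /orP[/eqP/tP->|ut].
    by rewrite nt /in_block leqnn ltnW.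
  by case: (W u) => [|_ fu]; rewrite /in_block ?fu; lia.
split=> // u v /andP[ju ut] /andP[jv vt] uv.
have S (a b : V) : j <= a -> b <= top j -> b = a.+1 :> nat -> next c a = b.
  move=> ja bt ba; apply: val_inj; case: (W a) => [|_ fa]; first lia.
  by rewrite [LHS]fa [RHS]ba.
have S' (a b : V) : a = j :> nat -> b = top j :> nat -> next c b = a.
  by move=> aj /tP->; rewrite nt; apply: val_inj.
have : v = u.+1 :> nat \/ u = v.+1 :> nat \/ u = j :> nat /\ v = top j :> nat
    \/ v = j :> nat /\ u = top j :> nat.
  clear S S' IB W nt tc tP t fj gj; move: uv ju ut jv vt {topV jt}.
  by rewrite /nbr /up /top; case: (nat_of_ord j =P K.*2.+1) => ?; lia.
case=> [E|[E|[[E1 E2]|[E1 E2]]]].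
- by left; apply: S.
- by right; apply: S.
- by right; apply: S'.
- by left; apply: S'.
Qed.

Lemma simple_cycle_rev (c : seq (node chain)) :
  simple_cycle c -> simple_cycle (rev c).
Proof.
case=> c_gt2 /andP[cyc Uc]; split; first by rewrite size_rev.
rewrite /ucycle rev_uniq Uc andbT rev_cycle; apply: sub_cycle cyc => u v.
by case: chain_simple => _ ->.
Qed.

(** The least node [j] of a cycle has both its neighbours on the cycle above it. Only the start of a
    block has two higher neighbours, and they are [j.+1] and [top j]. *)
Lemma cycle_block (c : seq (node chain)) : simple_cycle c ->
  exists2 j, odd j && (j <= K.*2.+1) &
    (forall v, (v \in c) = in_block j v) /\ cycle_edges c = block_edges j.
Proof.
move=> C; have [c_gt2 /andP[cyc Uc]] := C.
have [v0 v0c] : exists v, v \in c.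
  by case: c c_gt2 {C cyc Uc} => // v c' _; exists v; rewrite mem_head.
case: (arg_minnP (fun v : V => val v) v0c) => j jc jmin.
have up_le (u : node chain) : u \in c -> nbr j u -> up j u.
  by move=> /jmin /= ju; rewrite /nbr => /orP[//|]; rewrite /up; lia.
have un := up_le _ (etrans (mem_next c j) jc) (chain_next C jc).
have pn := up_le _ (etrans (mem_prev c j) jc) (chain_prev C jc).
have two_up (n p : node chain) : up j n -> up j p -> n != p ->
    [/\ odd j, j <= K.*2.+1 &
     (n = j.+1 :> nat /\ p = top j :> nat) \/
     (p = j.+1 :> nat /\ n = top j :> nat)].
  rewrite -val_eqE /= /up /top.
  by case: (nat_of_ord j =P K.*2.+1) => ?; split; lia.
have [j_odd jK jj] := two_up _ _ un pn (next_neq_prev Uc c_gt2 jc).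
exists (val j); first by rewrite j_odd.
have [IB NB] : (forall v, (v \in c) = in_block j v) /\
    (forall u v : V, in_block j u -> in_block j v -> nbr u v ->
      next c u = v \/ next c v = u).
  (* Reversing the cycle turns the second orientation into the first. *)
  case: jj => -[nj pj]; first exact: ascending_cycle.
  have [] := @ascending_cycle (rev c) j;
    rewrite ?mem_rev ?next_rev ?prev_rev //.
  - exact: simple_cycle_rev.
  - by move=> v; rewrite mem_rev; apply: jmin.
  move=> IB NB; split=> [v|u v ub vb uv]; first by rewrite -IB mem_rev.
  case: (NB u v ub vb uv); rewrite next_rev // => <-;
    rewrite next_prev //; by [right | left].
split=> //; apply/setP=> E; rewrite inE; apply/imsetP/existsP.
  case=> u uc ->; exists u; apply/existsP; exists (next c u).
  by rewrite eqxx -!IB uc mem_next uc (chain_next C).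
case=> u /existsP[v /and4P[/eqP-> ub vb uv]].
case: (NB u v ub vb uv) => <-; first by exists u; rewrite ?IB.
by exists v; rewrite ?IB // setUC.
Qed.

Lemma chain_cactus_cycles (c1 c2 : seq (node chain)) :
  simple_cycle c1 -> simple_cycle c2 ->
  cycle_edges c1 = cycle_edges c2 \/ #|[predI c1 & c2]| <= 1.
Proof.
move=> /cycle_block[j1 /andP[odd1 le1] [B1 E1]].
move=> /cycle_block[j2 /andP[odd2 le2] [B2 E2]].
rewrite E1 E2; have [->|j12] := eqVneq j1 j2; [by left|right].
apply/card_le1_eqP => u v; rewrite !inE !B1 !B2 /in_block /top => u12 v12.
by apply: val_inj; move: u12 v12; case: eqP; case: eqP => ? ? /=; lia.
Qed.

(** Alternating ports would put [next c1 v] two below [v] and [prev c1 v] above [v], so that [c1]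
    would run through two blocks. *)
Lemma chain_ports : ccw_ports chain.
Proof.
move=> c1 c2 v C1 C2 vc1 vc2.
have A (u : node chain) : nbr v u -> adj v u by rewrite adjE.
have [n1 p1] := (chain_next C1 vc1, chain_prev C1 vc1).
have [n2 p2] := (chain_next C2 vc2, chain_prev C2 vc2).
case=> /(port_lt (A _ n1) (A _ n2)) l1 /(port_lt (A _ n2) (A _ p1)) l2.
move=> /(port_lt (A _ p1) (A _ p2)) l3.
have [v2 vp] : v = (next c1 v).+2 :> nat /\ v < prev c1 v.
  by move: n1 p1 n2 p2; rewrite /nbr /up; lia.
have [j /andP[j_odd jK] [B _]] := cycle_block C1.
have := B (next c1 v); have := B (prev c1 v).
rewrite mem_next mem_prev vc1 /in_block /top => /esym pj /esym nj.
move: n1 pj nj {n2 p1 p2 A B}; rewrite /nbr /up.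
by case: (j =P K.*2.+1) => ?; lia.
Qed.

End Footprint.

Lemma set2_eq (T : finType) (u v a b : T) :
  ([set u; v] == [set a; b]) =
    ((u == a) && (v == b)) || ((u == b) && (v == a)).
Proof.
apply/eqP/orP => [E|[]/andP[/eqP-> /eqP->] //]; last exact: setUC.
have := set21 u v; have := set22 u v; have := set21 a b; have := set22 a b.
rewrite {1 2}E -{1 2}E !inE.
by do 4![case/orP=> /eqP ?]; subst; rewrite ?eqxx; auto.
Qed.

(** * The missing edges *)

Section Gates.
Variable K : nat.
Local Notation V := 'I_(K.*2 + 4).+1.
Local Notation chain := (chain K).

(* [barred occ e a b]: the edge from a to b, where a < b, is removed; [occ] tells
   which nodes are occupied and [e] is the edge removed in the last cycle. *)
Definition barred (occ : pred nat) (e : nat * nat) (a b : nat) :=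
  [&& odd b, 2 < b, b <= K.*2.+1 & a == if occ (b - 2) then b - 2 else b - 1]
    || ((a == e.1) && (b == e.2)).

(** Every triangle loses one of the two edges into its exit [i.*2.+3]; with the last edge this makes
    at most K + 1 edges. *)
Definition gates (occ : pred nat) (e : nat * nat) : {set {set node chain}} :=
  [set inord e.1; inord e.2] |:
  [set [set inord (if occ i.*2.+1 then i.*2.+1 else i.*2.+2);
            inord i.*2.+3] | i : 'I_K].

(** The edges w z, w x and y z of the quadrilateral; x y is never removed. *)
Definition last_edge (e : nat * nat) :=
  [|| e == (K.*2.+1, K.*2.+4), e == (K.*2.+1, K.*2.+2)
    | e == (K.*2.+3, K.*2.+4)].

Lemma last_edgeP e : last_edge e ->
  e.1 <= K.*2.+3 /\ K.*2.+1 < e.2 <= K.*2.+4.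
Proof. by rewrite /last_edge; case/or3P=> /eqP-> /=; split; lia. Qed.

Lemma barred_low occ e a b : last_edge e -> b <= K.*2.+1 ->
  barred occ e a b =
    [&& odd b, 2 < b & a == if occ (b - 2) then b - 2 else b - 1].
Proof.
case/last_edgeP=> _ /andP[e2 _] bK; rewrite /barred bK /=.
by rewrite (_ : b == e.2 = false) ?andbF ?orbF //; lia.
Qed.

Lemma barred_high occ e a b : K.*2.+1 < b ->
  barred occ e a b = (a == e.1) && (b == e.2).
Proof. by rewrite ltnNge /barred => /negPf->; rewrite !andbF. Qed.

Lemma inord_eq n (v : V) :
  n < (K.*2 + 4).+1 -> (v == inord n) = (v == n :> nat).
Proof. by move=> n_lt; rewrite -val_eqE /= inordK. Qed.

Lemma last_edge_lt e : last_edge e ->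
  e.1 < (K.*2 + 4).+1 /\ e.2 < (K.*2 + 4).+1.
Proof. by case/last_edgeP; lia. Qed.

Lemma barred_up occ e (a b : nat) :
  last_edge e -> barred occ e a b -> up K a b.
Proof.
move=> le; rewrite /up; case: (leqP b K.*2.+1) => bK.
  by rewrite barred_low //; case: ifP => _; lia.
rewrite barred_high // => /andP[/eqP-> /eqP->].
by case/or3P: le => /eqP-> /=; lia.
Qed.

Lemma in_gates occ e (u v : V) : last_edge e ->
  ([set u; v] \in gates occ e) = barred occ e u v || barred occ e v u.
Proof.
case/last_edge_lt=> e1 e2; rewrite /gates in_setU1 set2_eq !inord_eq //.
rewrite /barred; apply/orP/idP => [[|/imsetP[i _ /eqP]]|].
  by case/orP=> [->|]; [|rewrite andbC => ->]; rewrite ?orbT.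
  have iK := ltn_ord i.
  rewrite set2_eq !inord_eq //;
    do ?[by case: ifP; lia | by lia].
  case/orP=> /andP[/eqP-> /eqP->].
    apply/orP; left; apply/orP; left; rewrite !subSS !subn0 /= eqxx.
    by rewrite odd_double /=; lia.
  apply/orP; right; apply/orP; left; rewrite !subSS !subn0 /= eqxx.
  by rewrite odd_double /=; lia.
have H (a b : V) : [&& odd b, 2 < b, b <= K.*2.+1 &
      val a == if occ (b - 2) then b - 2 else b - 1] ->
    exists2 i : 'I_K, true & [set a; b] =
      [set inord (if occ i.*2.+1 then i.*2.+1 else i.*2.+2); inord i.*2.+3].
  case/and4P=> b_odd b2 bK /eqP aE.
  have [i iE] : exists i : 'I_K, i.*2.+3 = b.
    have iP : (b - 3)./2 < K by lia.
    by exists (Ordinal iP); rewrite /=; lia.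
  have := ltn_ord a; have := ltn_ord b.
  move: aE; rewrite -{1 2 3 4}iE !subSS !subn0 => aE bV aV.
  exists i => //; congr [set _; _]; apply: val_inj; rewrite /= inordK -?aE //.
case/orP=> /orP[/H[i _ E]|E].
- by right; apply/imsetP; exists i.
- by left; rewrite E.
- by right; rewrite setUC; apply/imsetP; exists i.
- by left; rewrite andbC in E; rewrite E orbT.
Qed.

Lemma gates_edges occ e : last_edge e -> gates occ e \subset edges chain.
Proof.
move=> le; apply/subsetP=> E gE.
have [u [v def_E]] : exists u v, E = [set u; v].
  move: gE; rewrite in_setU1 => /orP[/eqP->|/imsetP[i _ ->]]; eauto.
move: gE; rewrite def_E in_gates // => b.
apply/imset2P; exists u v => //.
by rewrite -/(adj _ _) adjE /nbr; case/orP: b => /(barred_up le) ->;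
  rewrite ?orbT.
Qed.

Lemma gates_card occ e : #|gates occ e| <= K.+1.
Proof.
rewrite cardsU1; apply: (@leq_add _ _ 1 K); first exact: leq_b1.
by apply: leq_trans (leq_imset_card _ _) _; rewrite card_ord.
Qed.

Lemma presentE occ e (u v : node chain) : last_edge e ->
  present (gates occ e) u v =
    nbr K u v && ~~ (barred occ e u v || barred occ e v u).
Proof. by move=> le; rewrite /present adjE in_gates. Qed.

Lemma present_nbr M (u v : node chain) : present M u v -> nbr K u v.
Proof. by rewrite /present adjE => /andP[]. Qed.

Lemma gates_shut occ a b (u v : node chain) : last_edge (a, b) ->
  present (gates occ (a, b)) u v ->
  ~ (u = a :> nat /\ v = b :> nat) /\ ~ (v = a :> nat /\ u = b :> nat).
Proof.
move=> le; rewrite presentE // negb_or /barred => /and3P[_ n1 n2].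
split=> -[ua vb]; [move: n1 | move: n2];
  by rewrite ua vb !eqxx orbT.
Qed.

(** By induction on the node number, node 0 is connected to every node; symmetry of [present] does
    the rest. *)
Lemma connected_if_consecutive (M : {set {set node chain}}) :
    (forall u v : node chain, v = u.+1 :> nat -> connect (present M) u v) ->
  connected_without M.
Proof.
move=> H.
have sym : connect_sym (present M).
  apply: sym_connect_sym => u v; rewrite /present setUC.
  by case: (chain_simple K) => _ ->.
have O (v : node chain) : connect (present M) ord0 v.
  case: v => n; elim: n => [|n IHn] n_lt.
    by rewrite (_ : ord0 = Ordinal n_lt) ?connect0 //; apply: val_inj.
  apply: (connect_trans (IHn (ltnW n_lt))); exact: H.
by move=> u v; apply: connect_trans (O v); rewrite sym.
Qed.

(** Every cycle loses a single edge, which the rest of the cycle bypasses. *)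
Lemma gates_connected occ e : last_edge e -> connected_without (gates occ e).
Proof.
move=> le; apply: connected_if_consecutive => u v uv.
have nV n : n < (K.*2 + 4).+1 -> @inord (K.*2 + 4) n = n :> nat.
  exact: inordK.
have P (a b : node chain) : up K a b -> ~~ barred occ e a b ->
    connect (present (gates occ e)) a b /\ connect (present (gates occ e)) b a.
  move=> ab nb; suff nb' : ~~ barred occ e b a.
    by split; apply: connect1; rewrite presentE // /nbr ab ?orbT negb_or nb nb'.
  by apply/negP => /(barred_up le); move: ab; rewrite /up; lia.
have uvK : up K u v by rewrite /up uv eqxx.
have [b|/(P _ _ uvK)[]//] := boolP (barred occ e u v).
have vV := ltn_ord v; case: (leqP v K.*2.+1) => vK.
  move: (vK) b => vK'; rewrite barred_low // => /and3P[v_odd v2].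
  case: ifP => [_ /eqP|ou _]; first by lia.
  (* The missing edge goes from the middle node of a triangle to its exit; the detour leads through
     the entrance [u.-1], which is unoccupied. *)
  have u0 : u.-1 < (K.*2 + 4).+1 by lia.
  have [||_ s1] := P (Ordinal u0) u; rewrite /= ?barred_low //; try lia.
    by rewrite /up; lia.
  have [||s2 _] := P (Ordinal u0) v; rewrite /= ?barred_low ?ou //; try lia.
    by rewrite /up; lia.
  exact: connect_trans s2.
have nR n n' : K.*2.+1 <= n -> K.*2.+1 < n' -> n' <= K.*2.+4 -> up K n n' ->
    (n == e.1) && (n' == e.2) = false ->
    connect (present (gates occ e)) (inord n : node chain) (inord n') /\
    connect (present (gates occ e)) (inord n' : node chain) (inord n).
  move=> n1 n'1 n'2 nn' ne; have n_lt : n < n' by move: nn'; rewrite /up; lia.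
  by apply: P; rewrite !nV ?barred_high ?ne //; lia.
move: b; rewrite barred_high // => /andP[/eqP ue /eqP ve].
have uE : u = inord e.1 by apply: val_inj; rewrite /= -ue nV.
have vE : v = inord e.2 by apply: val_inj; rewrite /= -ve nV.
have upS n : up K n n.+1 by rewrite /up eqxx.
have upL : up K K.*2.+1 K.*2.+4 by rewrite /up !eqxx !orbT.
(* The nodes w and z are not consecutive; w x and y z are each bypassed by the three other edges of
   the quadrilateral. *)
move: le ue ve uv; rewrite uE vE => /or3P[]/eqP eE; rewrite eE /= => ue ve uv.
- by lia.
- have [||||| wz _] := nR K.*2.+1 K.*2.+4; rewrite ?eE //=; try lia.
  have [||||| _ zy] := nR K.*2.+3 K.*2.+4; rewrite ?eE //=; try lia.
  have [||||| _ yx] := nR K.*2.+2 K.*2.+3; rewrite ?eE //=; try lia.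
  rewrite -eE; exact: connect_trans wz (connect_trans zy yx).
- have [||||| wz _] := nR K.*2.+1 K.*2.+4; rewrite ?eE //=; try lia.
  have [||||| _ yx] := nR K.*2.+2 K.*2.+3; rewrite ?eE //=; try lia.
  have [||||| _ xw] := nR K.*2.+1 K.*2.+2; rewrite ?eE //=; try lia.
  rewrite -eE; exact: connect_trans yx (connect_trans xw wz).
Qed.

Lemma chain_cactus : cactus chain.
Proof.
split; [exact: chain_simple | | exact: chain_cactus_cycles].
apply: connected_if_consecutive => u v uv; apply: connect1.
by rewrite /present adjE inE uv /nbr /up eqxx.
Qed.

Definition chain_scenario (M : nat -> {set {set node chain}}) (b : V) :=
  @Scenario chain M ord0 b.

Lemma chain_admissible m M (b : V) :
    m <= K.+2 -> b != ord0 -> M 0 = set0 ->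
    (forall r, 0 < r -> exists2 oe, last_edge oe.2 & M r = gates oe.1 oe.2) ->
  admissible K.+1 m (chain_scenario M b).
Proof.
move=> mK b0 M0 MP.
have MC r : M r = set0 \/ exists2 oe, last_edge oe.2 & M r = gates oe.1 oe.2.
  by case: r => [|r]; [left | right; apply: MP].
split=> //=.
- exact: chain_cactus.
- exact: chain_ports.
- by move=> r; case: (MC r) => [->|[oe le ->]]; rewrite ?sub0set ?gates_edges.
- by move=> r; case: (MC r) => [->|[oe le ->]]; rewrite ?cards0 ?gates_card.
- move=> r; case: (MC r) => [->|[oe le ->]]; last exact: gates_connected.
  by case: chain_cactus.
- by rewrite card_ord; lia.
- by rewrite eq_sym.
Qed.

End Gates.

(** Hence a view that occurs at one node in two scenarios with different black holes cannot give
    knowledge of the location. *)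
Lemma leads_inj (G : network) s (u v1 v2 : node G) :
  leads s u v1 -> leads s u v2 -> v1 = v2.
Proof.
elim: s u => [|p s IHs] u /=; first by move=> /eqP<- /eqP.
by case/andP=> _ l1 /andP[_]; apply: IHs l1.
Qed.

(** * Runs that look the same at a node *)

Section Runs.
Variables (m : nat) (A : algorithm) (G : network) (h : node G).
Local Notation team := ('I_m -> option (agent (node G))).

(** [M r] affects the run only after the beginning of round [r], so the run and its missing edges
    can be built together, round by round. *)
Lemma adaptive_adversary (b : node G)
    (strategy : nat -> team -> {set {set node G}}) :
  exists M, forall r,
    M r = strategy r (agents (run m A (@Scenario G M h b) r)).
Proof.
(* The type of a configuration depends on the scenario, which is not known yet; only the team and
   the whiteboards are carried along. *)
pose play := fix play r : team * (node G -> seq bool) :=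
  if r is r'.+1 then
    let c := play r' in
    let S := @Scenario G (fun _ => strategy r' c.1) h b in
    let c' := step A r' (@Config m S c.1 c.2) in (agents c', board c')
  else let c := start m A (@Scenario G (fun _ => set0) h b) in
    (agents c, board c).
exists (fun r => strategy r (play r).1) => r; congr strategy.
set S := Scenario _ _ _.
suff -> : run m A S r = @Config m S (play r).1 (play r).2 by [].
by elim: r => //= r ->.
Qed.

Section Joint.
Variables (M1 M2 : nat -> {set {set node G}}) (b1 b2 : node G).
Local Notation S1 := (@Scenario G M1 h b1).
Local Notation S2 := (@Scenario G M2 h b2).

(** All that a step at [v] depends on. Agents are compared only at [v]: elsewhere the runs may
    differ. *)
Definition same_at r (c1 : config m S1) (c2 : config m S2) (v : node G) :=
  [/\ board c1 v = board c2 v,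
      forall i (a : agent (node G)), pos a = v ->
        agents c1 i = Some a <-> agents c2 i = Some a &
      forall u, ([set v; u] \in M1 r) = ([set v; u] \in M2 r)].

(** [agent_at] and [active_at] both have this shape. *)
Lemma same_read r (c1 : config m S1) (c2 : config m S2) v
    (B : Type) (f : agent (node G) -> B) (e : B) i : same_at r c1 c2 v ->
  (if agents c1 i is Some a then if pos a == v then f a else e else e) =
  (if agents c2 i is Some a then if pos a == v then f a else e else e).
Proof.
case=> _ Ea _.
case E1: (agents c1 i) => [a1|]; case E2: (agents c2 i) => [a2|] //.
- case: eqP => [p1|p1].
    by move/(Ea i _ p1): E1; rewrite E2 => -[->]; rewrite p1 eqxx.
  case: eqP => // p2; move/(Ea i _ p2): E2.
  by rewrite E1 => -[E]; rewrite E in p1.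
- by case: eqP => // p1; move/(Ea i _ p1): E1; rewrite E2.
- by case: eqP => // p2; move/(Ea i _ p2): E2; rewrite E1.
Qed.

Lemma same_view r (c1 : config m S1) (c2 : config m S2) v :
  same_at r c1 c2 v -> view_at r c1 v = view_at r c2 v.
Proof.
move=> same; have [Eb _ Em] := same; rewrite /view_at; congr View => //.
  by apply: eq_filter => p; apply: Em.
by apply: eq_pmap => i; apply: same_read same.
Qed.

Lemma same_board_step r (c1 : config m S1) (c2 : config m S2) v :
  same_at r c1 c2 v -> board (step A r c1) v = board (step A r c2) v.
Proof.
move=> same; have [Eb _ _] := same; rewrite /= (same_view same) Eb.
by congr (if _ then _ else _); apply: eq_existsb => i; apply: same_read same.
Qed.

(** Equal views give equal decisions; the one possible difference is whether the node entered is the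
    black hole. *)
Lemma same_step r (c1 : config m S1) (c2 : config m S2) i (a : agent (node G)) :
    same_at r c1 c2 (pos a) -> agents c1 i = Some a -> agents c2 i = Some a ->
  (exists2 a' : agent (node G), pos a' = pos a &
     agents (step A r c1) i = Some a' /\ agents (step A r c2) i = Some a') \/
  (exists2 a' : agent (node G), present (M1 r) (pos a) (pos a') &
     agents (step A r c1) i = (if pos a' == b1 then None else Some a') /\
     agents (step A r c2) i = (if pos a' == b2 then None else Some a')).
Proof.
move=> same E1 E2; rewrite /= /step_agent E1 E2 (same_view same).
case: ifP => _; first by left; exists a.
have stay mu ht : exists2 a' : agent (node G), pos a' = pos a &
  Some (Agent (pos a) mu None ht) = Some a' /\
  Some (Agent (pos a) mu None ht) = Some a' by eexists; [|by split].
have [_ _ Em] := same.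
case: (decide _ _ _) => [|p|]; [by left | | by left].
rewrite /= (_ : present (M2 r) _ _ =
  present (M1 r) (pos a) (nth (pos a) (links (pos a)) p)); last first.
  by rewrite /present Em.
case: ifP => [/andP[_ pr]|_]; last by left.
right; set t := nth _ _ _ in pr *.
by exists (Agent t (update A (ident i) (view_at r c2 (pos a)))
             (Some (port t (pos a))) false).
Qed.

End Joint.

Section Single.
Variables (M : nat -> {set {set node G}}) (b : node G).
Local Notation S := (@Scenario G M h b).
Local Notation team_at r := (agents (run m A S r)).

Lemma agent_step r i (a : agent (node G)) : team_at r i = Some a ->
  (exists2 a' : agent (node G), pos a' = pos a & team_at r.+1 i = Some a') \/
  (exists2 a' : agent (node G), present (M r) (pos a) (pos a') &
     team_at r.+1 i = if pos a' == b then None else Some a').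
Proof.
(* The run is compared with itself. *)
have same : same_at r (run m A S r) (run m A S r) (pos a) by split.
move=> E; case: (same_step same E E) => [[a' p [E' _]]|[a' p [E' _]]].
  by left; exists a'.
by right; exists a'.
Qed.

Lemma agent_stepS r i (a' : agent (node G)) : team_at r.+1 i = Some a' ->
  exists2 a : agent (node G), team_at r i = Some a &
    pos a' = pos a \/ present (M r) (pos a) (pos a') /\ pos a' <> b.
Proof.
move=> E'; case E: (team_at r i) => [a|]; last first.
  by move: E'; rewrite /= /step_agent E.
exists a => //; case: (agent_step E) => [[a1 p1]|[a1 p1]]; rewrite E'.
  by case=> ->; left.
by case: eqP => // p2 [->]; right.
Qed.

Lemma lost_forever r r' i :
  r <= r' -> team_at r i = None -> team_at r' i = None.
Proof.
move=> /subnK<-; elim: (r' - r) => // n IHn E.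
by rewrite addSn /= /step_agent IHn.
Qed.

Lemma alive_off_black_hole r i (a : agent (node G)) :
  h != b -> team_at r i = Some a -> pos a <> b.
Proof.
move=> /eqP hb; elim: r a => [|r IHr] a; first by case=> <-.
by case/agent_stepS=> a0 /IHr a0b [->|[]].
Qed.

End Single.
End Runs.

(** * The three scenarios *)

Section Game.
Variables (K m : nat) (A : algorithm).
Hypothesis m_le : m <= K.+2.
Local Notation V := (node (chain K)).
Local Notation team := ('I_m -> option (agent V)).
Local Notation nd n := (inord n : 'I_(K.*2 + 4).+1).
Local Notation w := K.*2.+1.
Local Notation x := K.*2.+2.
Local Notation y := K.*2.+3.
Local Notation z := K.*2.+4.

Lemma ndE n : n <= z -> nd n = n :> nat.
Proof. by move=> nz; rewrite inordK //; lia. Qed.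

Lemma nd_eq (v : V) n : n <= z -> (v == nd n) = (v == n :> nat).
Proof. by move=> nz; rewrite -val_eqE /= ndE. Qed.

Definition occupied (f : team) : pred nat :=
  fun n => [exists i, if f i is Some a then pos a == n :> nat else false].

Definition lost (f : team) := [exists i, ~~ isSome (f i)].

(** In the run [X] the black hole is x, so a lost agent is the sign that x has been entered. *)
Definition last_x (f : team) :=
  if ~~ lost f then (w, z) else if occupied f y then (y, z) else (w, x).

Definition last_y (f : team) := if lost f then (w, x) else (w, z).

Lemma last_x_edge f : last_edge K (last_x f).
Proof.
by rewrite /last_x /last_edge; do !case: ifP => _; rewrite eqxx ?orbT.
Qed.

Lemma last_y_edge f : last_edge K (last_y f).
Proof. by rewrite /last_y /last_edge; case: ifP => _; rewrite eqxx ?orbT. Qed.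

Variable Mx : nat -> {set {set V}}.
Local Notation Cx r := (run m A (chain_scenario Mx (nd x)) r).
Definition X r : team := agents (Cx r).
(** An equation and not a definition, since [X] depends on [Mx]; [adaptive_adversary] provides a
    solution. *)
Hypothesis MxE : forall r,
  Mx r = if r is 0 then set0 else gates K (occupied (X r)) (last_x (X r)).

(* [My] serves two scenarios, the black hole being y or z, but it is computed
   from the run [X], where the black hole is x. *)
Definition My r :=
  if r is 0 then set0 else gates K (occupied (X r)) (last_y (X r)).
Local Notation C b r := (run m A (chain_scenario My b) r).
Definition Y b r : team := agents (C b r).

Lemma lostP r : reflect (exists i, X r i = None) (lost (X r)).
Proof.
apply: (iffP existsP) => -[i E]; exists i; last by rewrite E.
by case: (X r i) E.
Qed.

Lemma occupiedP f n :
  reflect (exists i, exists2 a : agent V, f i = Some a & pos a = n :> nat)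
    (occupied f n).
Proof.
apply: (iffP existsP) => [[i]|[i [a E p]]].
  by case E: (f i) => [a|] // /eqP an; exists i; exists a.
by exists i; rewrite E; apply/eqP.
Qed.

Lemma lost_mono r r' : r <= r' -> lost (X r) -> lost (X r').
Proof.
by move=> rr /lostP[i E]; apply/lostP; exists i; apply: lost_forever E.
Qed.

Lemma home_neq n : 0 < n <= z -> ord0 != nd n.
Proof. by case/andP=> n0 nz; rewrite nd_eq //= eq_sym -lt0n. Qed.

Lemma not_at_x r i (a : agent V) : X r i = Some a -> pos a <> x :> nat.
Proof.
move=> /alive_off_black_hole H E.
have /H : ord0 != nd x by apply: home_neq; lia.
by apply; apply: val_inj; rewrite /= ndE //; lia.
Qed.

Lemma start_home M b i (a : agent V) :
  agents (run m A (chain_scenario M b) 0) i = Some a -> pos a = 0 :> nat.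
Proof. by case=> <-. Qed.

Lemma Mx_gates r : 0 < r -> Mx r = gates K (occupied (X r)) (last_x (X r)).
Proof. by rewrite MxE; case: r. Qed.

(** Destroyed agents count as outside, and so do those at [i.*2.+1], where the next block begins. *)
Definition outside i (f : team) : {set 'I_m} :=
  [set j | if f j is Some a then i.*2 < pos a else true].

(* If the entrance 2i+1 of the triangle i is occupied at round r, an agent there
   is outside the first i triangles but cannot leave the first i+1 ones, which
   can only be left by agents that were outside the first i ones. Otherwise
   nobody leaves the first i+1 triangles. *)
Lemma outside_bound r i : i <= K -> #|outside i (X r)| + i <= K.+2.
Proof.
(* No step from a node below w is fatal: the neighbours of x are w and y. *)
have stepX j r' (a : agent V) : X r' j = Some a -> pos a < w ->
    (exists2 a' : agent V, X r'.+1 j = Some a' & pos a' = pos a) \/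
    (exists2 a' : agent V, present (Mx r') (pos a) (pos a') &
       X r'.+1 j = Some a').
  move=> E pa; case: (agent_step E) => [[a' p' E']|[a' p']].
    by left; exists a'.
  case: eqP => [px|_ E']; last by right; exists a'.
  by have := present_nbr p'; rewrite px ndE // /nbr /up; lia.
elim: r i => [|r IHr] i iK.
  suff -> : outside i (X 0) = set0 by rewrite cards0; lia.
  by apply/setP=> j; rewrite !inE.
case: i iK => [_|i iK].
  by rewrite addn0 (leq_trans (max_card _)) // card_ord.
(* At round 0 no edge is missing, but from home only node 1 can be reached. *)
have [Er|r_gt0] := posnP r.
  suff -> : outside i.+1 (X r.+1) = set0 by rewrite cards0; lia.
  apply/setP=> j; rewrite !inE Er.
  have E : X 0 j = Some (Agent (ord0 : V) (init A (ident j)) None false) by [].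
  case: (stepX _ _ _ E) => [//|[a' -> /= ->]|[a' /present_nbr n ->]] //.
  by move: n; rewrite /nbr /up /=; lia.
have barr (a b : V) : present (Mx r) a b -> nbr K a b /\
    (b = i.*2.+3 :> nat ->
     a <> (if occupied (X r) i.*2.+1 then i.*2.+1 else i.*2.+2) :> nat).
  move=> pr; split=> [|bE aE]; first exact: present_nbr pr.
  move: pr; rewrite Mx_gates // presentE ?last_x_edge // negb_or.
  case/and3P=> _ + _.
  rewrite barred_low ?last_x_edge //; last by lia.
  by rewrite bE aE !subSS !subn0 eqxx /= odd_double.
have [occ|free] := boolP (occupied (X r) i.*2.+1).
  case/occupiedP: (occ) => j0 [a0 E0 p0].
  have j0o : j0 \in outside i (X r) by rewrite inE E0 p0.
  suff sub : outside i.+1 (X r.+1) \subset outside i (X r) :\ j0.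
    have := IHr i (ltnW iK); rewrite (cardsD1 j0) j0o add1n addSnnS.
    by move=> l; apply: leq_trans l; rewrite leq_add2r subset_leq_card.
  apply/subsetP=> j; rewrite !inE => jo; apply/andP; split.
    apply: contraTneq jo => ->.
    case: (stepX _ _ _ E0) => [|[a' -> ->]|[a' /barr[n nb] ->]];
      rewrite -?leqNgt.
    - by lia.
    - by rewrite p0; lia.
    - by move: nb; rewrite occ; move: n; rewrite /nbr /up; lia.
  case E: (X r j) => [a|] //; rewrite ltnNge; apply/negP => pa; move: jo.
  apply/negP.
  case: (stepX _ _ _ E) => [|[a' -> ->]|[a' /barr[n _] ->]]; rewrite -?leqNgt.
  - by lia.
  - by lia.
  - by move: n; rewrite /nbr /up; lia.
suff sub : outside i.+1 (X r.+1) \subset outside i.+1 (X r).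
  by apply: leq_trans (IHr _ iK); rewrite leq_add2r subset_leq_card.
apply/subsetP=> j; rewrite !inE => jo.
case E: (X r j) => [a|] //; rewrite ltnNge; apply/negP => pa; move: jo.
apply/negP.
have pa1 : pos a <> i.*2.+1 :> nat.
  by move=> pE; case/negP: free; apply/occupiedP; exists j; exists a.
case: (stepX _ _ _ E) => [|[a' -> ->]|[a' /barr[n nb] ->]]; rewrite -?leqNgt //.
  by lia.
by move: nb; rewrite (negPf free); move: n; rewrite /nbr /up; lia.
Qed.

(** For [i = K], [outside_bound] leaves room for two agents. *)
Lemma few_outside r j1 j2 j3 :
  j1 \in outside K (X r) -> j2 \in outside K (X r) -> j3 \in outside K (X r) ->
  [\/ j1 = j2, j1 = j3 | j2 = j3].
Proof.
move=> o1 o2 o3; case: (j1 =P j2) => [|n12]; first by constructor 1.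
case: (j1 =P j3) => [|n13]; first by constructor 2.
case: (j2 =P j3) => [|n23]; first by constructor 3.
have : [set j1; j2; j3] \subset outside K (X r).
  apply/subsetP=> j; rewrite !inE => /orP[/orP[]|] /eqP->;
    by move: o1 o2 o3; rewrite !inE.
move/subset_leq_card; have := outside_bound r (leqnn K).
rewrite setUC cardsU1 cards2 !inE (eq_sym j3 j1) (eq_sym j3 j2).
by rewrite (introF eqP n12) (introF eqP n13) (introF eqP n23); lia.
Qed.

Lemma shut_x r (u v : V) a b : present (Mx r) u v -> 0 < r ->
  last_x (X r) = (a, b) ->
  ~ (u = a :> nat /\ v = b :> nat) /\ ~ (v = a :> nat /\ u = b :> nat).
Proof.
move=> pr r_gt0 le; apply: (@gates_shut K (occupied (X r))).
  by rewrite -le last_x_edge.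
by rewrite -le -Mx_gates.
Qed.

Lemma shut_y r (u v : V) a b : present (My r) u v -> 0 < r ->
  last_y (X r) = (a, b) ->
  ~ (u = a :> nat /\ v = b :> nat) /\ ~ (v = a :> nat /\ u = b :> nat).
Proof.
case: r => // r pr _ le; apply: (@gates_shut K (occupied (X r.+1))).
  by rewrite -le last_y_edge.
by rewrite -le.
Qed.

(** As long as nobody is lost, w z is missing after round 0, and the other edge from w into the
    quadrilateral leads to the black hole x. *)
Lemma unharmed r j (a : agent V) :
  ~~ lost (X r) -> X r j = Some a -> pos a <= w.
Proof.
elim: r j a => [|r IHr] j a; first by move=> _ /start_home ->.
move=> nl' E'; have nl : ~~ lost (X r) by apply: contra nl'; apply: lost_mono.
have [a0 E p] := agent_stepS E'; have := IHr _ _ nl E.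
case: p => [->//|[pr _]]; have n := present_nbr pr.
have := not_at_x E'; move: n; rewrite /nbr /up.
case: (posnP r) => [r0|r0].
  by rewrite r0 in E; rewrite (start_home E); lia.
have [] := @shut_x _ _ _ w z pr r0; first by rewrite /last_x nl.
by lia.
Qed.

Lemma start_not_lost : ~~ lost (X 0).
Proof. by apply/existsP => -[]. Qed.

Lemma lost_gt0 r : lost (X r) -> 0 < r.
Proof. by case: r => // l; case/negP: start_not_lost. Qed.

Lemma two_left r j1 j2 (a1 a2 : agent V) : lost (X r) ->
  X r j1 = Some a1 -> X r j2 = Some a2 -> w <= pos a1 -> w <= pos a2 -> j1 = j2.
Proof.
case/lostP=> d Ed E1 E2 p1 p2.
have od : d \in outside K (X r) by rewrite inE Ed.
have o1 : j1 \in outside K (X r) by rewrite inE E1.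
have o2 : j2 \in outside K (X r) by rewrite inE E2.
case: (few_outside od o1 o2) => // dj; first by rewrite dj E1 in Ed.
by rewrite dj E2 in Ed.
Qed.

(** * Black hole at x or at y *)

Definition core (v : V) := (v != x :> nat) && (v != y :> nat).

Lemma same_gates r (v : V) j (a : agent V) :
    core v -> X r j = Some a -> pos a = v ->
  forall u, ([set v; u] \in Mx r) = ([set v; u] \in My r).
Proof.
move=> cv E p u; rewrite MxE /My; case: r E => // r E.
rewrite !in_gates ?last_x_edge ?last_y_edge // /barred /last_x /last_y.
case: (boolP (lost _)) => l //=.
case: (boolP (occupied (X r.+1) y)) => // /occupiedP[j' [a' E' p']].
(* Otherwise the lost agent, the one at y and the one at [v] would be three agents outside. *)
have vw : v < w.
  rewrite ltnNge; apply/negP => wv.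
  have jj : j = j' by apply: (two_left l E E'); rewrite ?p // p'; lia.
  move: E; rewrite jj E' => -[aa]; move: cv.
  by rewrite /core -p -aa p' eqxx andbF.
congr (_ || _); congr (_ || _); apply/idP/idP; rewrite /=; lia.
Qed.

Lemma off_black_hole r b j (a : agent V) n : b = nd n -> 0 < n <= z ->
  Y b r j = Some a -> pos a <> n :> nat.
Proof.
move=> -> n_z /alive_off_black_hole H E; case: H; first exact: home_neq.
by apply: val_inj; rewrite /= ndE //; case/andP: n_z.
Qed.

(** Unlike [same_at], this leaves out the missing edges, which [same_gates] compares only at core
    nodes holding an agent. *)
Definition agree_at r (v : V) :=
  (forall j (a : agent V), pos a = v ->
     X r j = Some a <-> Y (nd y) r j = Some a) /\
  board (Cx r) v = board (C (nd y) r) v.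

Lemma exposed_lost r j (a : agent V) : X r j = Some a -> ~~ core (pos a) ->
  lost (X r) /\ pos a = y :> nat.
Proof.
move=> E nc; have px := not_at_x E.
have py : pos a = y :> nat by move: nc; rewrite /core; lia.
by split=> //; apply: contraT => /unharmed/(_ E); rewrite py; lia.
Qed.

(** Such an agent is at y: y z is missing because y is occupied after a loss, and x y leads to the
    black hole. *)
Lemma hidden_x r j (a a' : agent V) :
    X r j = Some a -> ~~ core (pos a) -> X r.+1 j = Some a' ->
  ~~ core (pos a').
Proof.
move=> E nc E'; have [l py] := exposed_lost E nc.
have [a0 E0] := agent_stepS E'; move: E0; rewrite -/(X r j) E => -[<-].
case=> [->//|[pr px]]; have n := present_nbr pr.
have occ : occupied (X r) y by apply/occupiedP; exists j; exists a.
have [] := @shut_x _ _ _ y z pr (lost_gt0 l); first by rewrite /last_x l occ.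
by move: n; rewrite /core /nbr /up py; have := not_at_x E'; lia.
Qed.

(** Such an agent is at x: w x is missing after a loss, and x y leads to the black hole. *)
Lemma hidden_y b r j (a a' : agent V) :
    b = nd y -> lost (X r) -> Y b r j = Some a -> ~~ core (pos a) ->
    Y b r.+1 j = Some a' ->
  ~~ core (pos a').
Proof.
move=> bE l E nc E'.
have py := off_black_hole bE (n := y) _ E.
have py' := off_black_hole bE (n := y) _ E'.
have [a0 E0] := agent_stepS E'; move: E0; rewrite -/(Y b r j) E => -[<-].
case=> [->//|[pr px]]; have n := present_nbr pr.
have [] := @shut_y _ _ _ w x pr (lost_gt0 l); first by rewrite /last_y l.
by move: n nc; rewrite /core /nbr /up; lia.
Qed.

(* The last edges [last_x] and [last_y] differ only when an agent is at y in the
   run [X]; then nobody else is at w or z, where the difference shows. *)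
Lemma agree r (v : V) : core v -> agree_at r v.
Proof.
elim: r v => [|r IHr] v cv; first by split.
have same j (a : agent V) : core (pos a) -> X r j = Some a ->
    same_at r (Cx r) (C (nd y) r) (pos a).
  move=> ca E; have [Ea Eb] := IHr _ ca; split=> //.
  exact: same_gates ca E erefl.
split; last first.
  have [/existsP[j]|/existsPn nact] := boolP [exists j, active_at (Cx r) v j].
    rewrite /active_at; case E: (agents _ j) => [a|//] /andP[/eqP pa _].
    rewrite -pa; apply: same_board_step; apply: same E; rewrite pa; exact: cv.
  have [Ea Eb] := IHr _ cv.
  rewrite /= ifN; last by apply/existsPn.
  rewrite ifN //; apply/existsPn => j; have := nact j.
  rewrite /active_at; case E2: (agents (C (nd y) r) j) => [a2|//].
  case: eqP => //= p2; have E1 := (Ea j a2 p2).2 E2.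
  by rewrite /X in E1; rewrite E1 p2 eqxx.
move=> j a' p'; have ca' : core (pos a') by rewrite p'.
have joint (a : agent V) :
    core (pos a) -> X r j = Some a -> Y (nd y) r j = Some a ->
    X r.+1 j = Some a' <-> Y (nd y) r.+1 j = Some a'.
  move=> ca E1 E2; have [] := same_step A (same j a ca E1) E1 E2.
    by case=> a1 _ [E1' E2']; rewrite /X /Y E1' E2'.
  case=> a1 _ [E1' E2']; rewrite /X /Y E1' E2' !nd_eq //; last by lia.
  (* As [a'] is in the core, the node entered is the black hole of neither run. *)
  move: ca'; rewrite /core => /andP[/negP n1 /negP n2].
  by split; case: ifP => // p1 [aa]; move: n1 n2; rewrite -aa p1;
    case: ifP => // ? [].
split=> E'.
  have [a E _] := agent_stepS E'; have [ca|nc] := boolP (core (pos a)).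
    by rewrite -(joint a) //; apply/((IHr _ ca).1 j a erefl).
  by have := hidden_x E nc E'; rewrite ca'.
have [a E0 _] := agent_stepS E'; have E : Y (nd y) r j = Some a := E0.
have [ca|nc] := boolP (core (pos a)).
  by rewrite (joint a) //; apply/((IHr _ ca).1 j a erefl).
(* In [X] this agent is destroyed or out of the core: alive in the core, it would be the same in
   both runs. *)
have l : lost (X r).
  case E1: (X r j) => [a1|]; last by apply/lostP; exists j.
  have [c1|nc1] := boolP (core (pos a1)); last by case: (exposed_lost E1 nc1).
  have := ((IHr _ c1).1 j a1 erefl).1 E1; rewrite E => -[aa].
  by case/negP: nc; rewrite aa.
by have := hidden_y erefl l E nc E'; rewrite ca'.
Qed.

Lemma agree_view j r (a : agent V) : core (pos a) -> X r j = Some a ->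
  view_at r (Cx r) (pos a) = view_at r (C (nd y) r) (pos a).
Proof.
move=> ca E; apply: same_view; have [Ea Eb] := agree r ca; split=> //.
exact: same_gates ca E erefl.
Qed.

Lemma admissible_x : admissible K.+1 m (chain_scenario Mx (nd x)).
Proof.
apply: chain_admissible; [exact: m_le | | exact: (MxE 0) | ].
  by rewrite eq_sym; apply: home_neq; lia.
move=> r r_gt0; exists (occupied (X r), last_x (X r)); last exact: Mx_gates.
exact: last_x_edge.
Qed.

Lemma admissible_y n :
  0 < n <= z -> admissible K.+1 m (chain_scenario My (nd n)).
Proof.
move=> n_z; apply: chain_admissible => //.
  by rewrite eq_sym; apply: home_neq.
case=> // r _; exists (occupied (X r.+1), last_y (X r.+1)) => //.
exact: last_y_edge.
Qed.

(** The same view occurs when the black hole is y. *)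
Lemma core_ignorant j r (a : agent V) : core (pos a) -> X r j = Some a ->
  ~~ halted a -> ~ knows_black_hole K.+1 A j (view_at r (Cx r) (pos a)).
Proof.
move=> ca E nh [s H].
have lx := H _ admissible_x r a E nh erefl.
have y_z : 0 < y <= z by lia.
have Ey := ((agree r ca).1 j a erefl).1 E.
have ly := H _ (admissible_y y_z) r a Ey nh (esym (agree_view ca E)).
have := leads_inj lx ly; move/(congr1 (@nat_of_ord _)); rewrite /= !ndE //; lia.
Qed.

(** While nobody is lost, all agents are at w or before it and cannot enter y or z in one step. The
    last step may be the one that enters x, since only the earlier rounds are assumed free of
    losses. *)
Lemma early_agree r v : (forall r', r' < r -> ~~ lost (X r')) ->
  (forall j, Y (nd y) r j = Y (nd z) r j) /\
  board (C (nd y) r) v = board (C (nd z) r) v.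
Proof.
elim: r v => [|r IHr] v nl; first by split.
have {}IHr := IHr _ (fun r' l => nl r' (ltnW l)).
have same u : same_at r (C (nd y) r) (C (nd z) r) u.
  have [Ea Eb] := IHr u; split=> // j a _.
  by rewrite -[agents (C (nd y) r) j]/(Y (nd y) r j) Ea.
split=> [j|]; last exact: same_board_step.
have nlr := nl r (ltnSn r).
case Ex: (X r j) => [a|]; last by case/lostP: nlr; exists j.
have pw := unharmed nlr Ex.
have ca : core (pos a) by rewrite /core; lia.
have Ey := ((agree r ca).1 j a erefl).1 Ex.
have Ez : Y (nd z) r j = Some a by rewrite -(IHr v).1.
have [] := same_step A (same (pos a)) Ey Ez.
  by case=> a1 _ [E1 E2]; rewrite /Y E1 E2.
case=> a1 pr [E1 E2]; rewrite /Y E1 E2.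
suff [ny nz] : (pos a1 == y :> nat) = false /\ (pos a1 == z :> nat) = false.
  by rewrite !nd_eq ?ny ?nz //; lia.
have n := present_nbr pr; have [r0|r_gt0] := posnP r.
  have p0 : pos a = 0 :> nat.
    by apply: (@start_home Mx (nd x) j); rewrite -Ex r0.
  by move: n; rewrite /nbr /up p0; lia.
have [] := @shut_y _ _ _ w z pr r_gt0; first by rewrite /last_y (negPf nlr).
by move: n; rewrite /nbr /up; lia.
Qed.

Lemma exposed_y r j (a : agent V) :
  Y (nd y) r j = Some a -> ~~ core (pos a) -> pos a = x :> nat.
Proof.
move=> E; have y_z : 0 < y <= z by lia.
by have := off_black_hole erefl y_z E; rewrite /core; lia.
Qed.

(** * Black hole at y or at z, seen by an agent alone at x *)

Section Isolated.
Variables (t : nat) (d : 'I_m).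
Hypotheses (before_t : forall r, r < t -> ~~ lost (X r)) (lost_t : lost (X t))
  (only_d : forall j, X t j = None -> j = d).

Lemma others_core_t j : j != d ->
  exists2 a : agent V, X t j = Some a & core (pos a).
Proof.
move=> jd; case E: (X t j) => [a|]; last by rewrite (only_d E) eqxx in jd.
exists a => //; have px := not_at_x E.
case t0 : t (lost_gt0 lost_t) => [//|r] _; rewrite t0 in E.
have nl : ~~ lost (X r) by apply: before_t; rewrite t0.
have [a0 E0] := agent_stepS E; have pw := unharmed nl E0.
rewrite /core; case=> [->|[/present_nbr n _]]; first by lia.
by move: n; rewrite /nbr /up; lia.
Qed.

(** From round [t] on w x is missing, and every other way from the core to x or y leads into the
    black hole, be it y or z. *)
Lemma others_core n r j (a : agent V) : n = y \/ n = z ->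
  t <= r -> j != d -> Y (nd n) r j = Some a -> core (pos a).
Proof.
move=> n_yz; have n_z : 0 < n <= z by lia.
move=> /subnK<-; elim: (r - t) a => [|q IHq] a jd E.
  have [a0 E0 c0] := others_core_t jd.
  have [Ea _] := early_agree ord0 before_t.
  have E1 := ((agree t c0).1 j a0 erefl).1 E0.
  have : Y (nd n) t j = Some a0 by case: n_yz => ->; rewrite -?Ea.
  by rewrite -[t]add0n E => -[->].
have l : lost (X (q + t)) by apply: lost_mono lost_t; rewrite leq_addl.
have [a0 E0] := agent_stepS E; have c0 := IHq _ jd E0.
case=> [->//|[pr pn]]; have nb := present_nbr pr.
have [] := @shut_y _ _ _ w x pr (lost_gt0 l); first by rewrite /last_y l.
have := off_black_hole erefl n_z E; have := off_black_hole erefl n_z E0.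
by move: nb c0; rewrite /core /nbr /up; lia.
Qed.

Lemma isolated_same r (a : agent V) : t <= r ->
    Y (nd y) r d = Some a -> Y (nd z) r d = Some a -> pos a = x :> nat ->
    board (C (nd y) r) (pos a) = board (C (nd z) r) (pos a) ->
  same_at r (C (nd y) r) (C (nd z) r) (pos a).
Proof.
move=> tr Ey Ez px Eb; split=> // j a1 p1; have [->|jd] := eqVneq j d.
  by move: Ey Ez; rewrite /Y => -> ->.
split=> E1.
  by have := others_core (or_introl erefl) tr jd E1; rewrite p1 /core px eqxx.
by have := others_core (or_intror erefl) tr jd E1; rewrite p1 /core px eqxx.
Qed.

(** With w x missing and y deadly, an agent found at x after [t] was already there one round before.
    Nobody else is at x, so it sees the same in both runs. *)
Lemma isolated r (a : agent V) : t <= r -> Y (nd y) r d = Some a ->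
  pos a = x :> nat ->
  Y (nd z) r d = Some a /\
  board (C (nd y) r) (pos a) = board (C (nd z) r) (pos a).
Proof.
move=> /subnK<-; elim: (r - t) a => [|q IHq] a E px.
  by have [Ea Eb] := early_agree (pos a) before_t; rewrite -Ea.
have l : lost (X (q + t)) by apply: lost_mono lost_t; rewrite leq_addl.
have y_z : 0 < y <= z by lia.
have [a0 E0 p0] := agent_stepS E; have ny := off_black_hole erefl y_z E0.
have px0 : pos a0 = x :> nat.
  case: p0 => [<-//|[pr _]]; have n := present_nbr pr.
  have [] := @shut_y _ _ _ w x pr (lost_gt0 l); first by rewrite /last_y l.
  by move: n; rewrite /nbr /up; lia.
have [Ez Eb] := IHq _ E0 px0.
have pp : pos a = pos a0 by apply: val_inj; rewrite /= px px0.
have same := isolated_same (leq_addl _ _) E0 Ez px0 Eb.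
split; last by rewrite pp; apply: same_board_step.
have [] := same_step A same E0 Ez.
  case=> a1 p1 [E1 E2]; move: E; rewrite /Y E1 => -[<-]; exact: E2.
case=> a1 pr [E1 _]; move: E; rewrite /Y E1; case: ifP => // _ [aa].
have n := present_nbr pr; move: n; rewrite aa pp /nbr /up; lia.
Qed.

Lemma isolated_ignorant r j (a : agent V) : Y (nd y) r j = Some a ->
  pos a = x :> nat -> ~~ halted a ->
  ~ knows_black_hole K.+1 A j (view_at r (C (nd y) r) (pos a)).
Proof.
move=> E px nh [s H].
(* Before [t] every agent is alive in [X], at w or before it, and the same in both runs. *)
have tr : t <= r.
  rewrite leqNgt; apply/negP => /before_t nl.
  case Ex: (X r j) => [a0|]; last by case/lostP: nl; exists j.
  have pw := unharmed nl Ex; have c0 : core (pos a0) by rewrite /core; lia.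
  have := ((agree r c0).1 j a0 erefl).1 Ex; rewrite E => -[aa].
  by move: pw; rewrite -aa px; lia.
have jd : j = d.
  apply/eqP/negPn/negP => jd.
  by have := others_core (or_introl erefl) tr jd E; rewrite /core px eqxx.
rewrite {}jd in E H; have [Ez Eb] := isolated tr E px.
have same := isolated_same tr E Ez px Eb.
have y_z : 0 < y <= z by lia.
have z_z : 0 < z <= z by lia.
have ly := H _ (admissible_y y_z) r a E nh erefl.
have lz := H _ (admissible_y z_z) r a Ez nh (esym (same_view same)).
have := leads_inj ly lz; move/(congr1 (@nat_of_ord _)); rewrite /= !ndE //; lia.
Qed.

End Isolated.

Lemma unsolvable : ~ solves_BHS K.+1 m A.
Proof.
move=> solves.
have [T [j [a [E nh _ kn]]]] := solves _ admissible_x.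
have Ex : X T j = Some a := E.
have [ca|nc] := boolP (core (pos a)); first exact: core_ignorant ca Ex nh kn.
have [lT pa] := exposed_lost Ex nc.
(* The living agent at y is outside too, which leaves room for a single lost one. *)
have only i1 i2 : X T i1 = None -> X T i2 = None -> i1 = i2.
  move=> E1 E2.
  have oj : j \in outside K (X T) by rewrite inE Ex pa; lia.
  have o1 : i1 \in outside K (X T) by rewrite inE E1.
  have o2 : i2 \in outside K (X T) by rewrite inE E2.
  by case: (few_outside oj o1 o2) => // ji; move: Ex; rewrite ji ?E1 ?E2.
have exl : exists r, lost (X r) by exists T.
have [t lt t_min] := ex_minnP exl.
have before_t r : r < t -> ~~ lost (X r).
  by move=> rt; apply: contraL rt => /t_min; rewrite -leqNgt.
case/lostP: (lt) => d Ed.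
have only_d i : X t i = None -> i = d.
  move=> Ei; apply: only; exact: lost_forever (t_min _ lT) _.
have y_z : 0 < y <= z by lia.
have [r [i [b [E' nhb _ knb]]]] := solves _ (admissible_y y_z).
have Ey : Y (nd y) r i = Some b := E'.
(* An agent that terminates in the core would have the same knowledge in [X]; otherwise it is at
   x. *)
have [cb|ncb] := boolP (core (pos b)).
  have Ex' := ((agree r cb).1 i b erefl).2 Ey.
  by apply: (core_ignorant cb Ex' nhb); rewrite (agree_view cb Ex').
exact: (isolated_ignorant before_t lt only_d Ey (exposed_y Ey ncb) nhb knb).
Qed.

End Game.

Theorem corollary2 (k m : nat) (A : algorithm) :
  1 < k -> within_space k m A -> solves_BHS k m A -> k + 2 <= m.
Proof.
case: k => // K _ _ solves; rewrite addn2 ltnNge; apply/negP => m_le.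
(* Nothing is removed at round 0, where the graph has to be the footprint itself. *)
have [Mx MxE] := @adaptive_adversary m A (chain K) ord0
  (inord K.*2.+2 : 'I_(K.*2 + 4).+1)
  (fun r f => if r is 0 then set0 else gates K (occupied f) (last_x f)).
exact: (unsolvable m_le MxE solves).
Qed.
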